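(* Let $s$ and $n$ be positive integers, let $\rho$ be a finite (possibly empty) sequence of integers each between $1$ and $s-1$, and let $r$ and $c$ be non-negative integers. Then the number of partitions $\lambda$ of $n$ with $\mathrm{rem}_s(\lambda)=\rho$ and $(r_s(\lambda),c_s(\lambda))=(r,c)$ equals the number of partitions $\lambda$ of $n$ with $\mathrm{rem}_s(\lambda)=\rho$ and $(r_s(\lambda),c_s(\lambda))=(c,r)$.
   Context: A partition $\lambda=(\lambda_1\ge\lambda_2\ge\dots\ge\lambda_\ell>0)$ is identified with its Ferrers diagram (English convention, row $i$ has $\lambda_i$ cells). For a cell $z$, the leg length $\mathrm{leg}(z)$ is the number of cells of the diagram strictly below $z$ in its column, and the arm length $\mathrm{arm}(z)$ is the number of cells strictly to the right of $z$ in its row. For a positive integer $s$: $r_s(\lambda)$ is the number of parts of $\lambda$ divisible by $s$; $c_s(\lambda)$ is the number of cells $z$ of $\lambda$ with $\mathrm{leg}(z)=0$ and $\mathrm{arm}(z)+1$ divisible by $s$. The remainder sequence $\mathrm{rem}_s(\lambda)$ is the sequence of non-zero remainders of the parts $\lambda_1,\lambda_2,\dots$ upon division by $s$, read from left to right (parts divisible by $s$ are skipped). *)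

(* Defs.v *)
From HB Require Import structures.
From mathcomp Require Import all_boot.

Set Implicit Arguments.
Unset Strict Implicit.
Unset Printing Implicit Defensive.

Definition is_partition (la : seq nat) : bool := sorted geq la && (0 \notin la).

Record partition_of (n : nat) : Type := PartitionOf {
  parts :> seq nat;
  _ : is_partition parts && (sumn parts == n) }.

HB.instance Definition _ n := [isSub for @parts n].
HB.instance Definition _ n := [Countable of partition_of n by <:].

(* Finiteness: a partition of n has at most n parts, each at most n. *)
Lemma size_le_sumn (la : seq nat) : 0 \notin la -> size la <= sumn la.
Proof.
elim: la => //= p la IH; rewrite inE negb_or eq_sym -lt0n => /andP[p0 /IH h].
by rewrite -add1n leq_add.
Qed.

Lemma part_le_sumn (la : seq nat) p : p \in la -> p <= sumn la.
Proof.
elim: la => //= q la IH; rewrite inE => /orP[/eqP-> | /IH h].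
  exact: leq_addr.
exact: leq_trans h (leq_addl _ _).
Qed.

Definition partition_to_bseq n (la : partition_of n) : n.-bseq 'I_n.+1 :=
  insub_bseq n (map inord la).
Definition partition_of_bseq n (b : n.-bseq 'I_n.+1) : option (partition_of n) :=
  insub (map val b).

Lemma partition_to_bseqK n :
  pcancel (@partition_to_bseq n) (@partition_of_bseq n).
Proof.
move=> [la laP]; rewrite /partition_to_bseq /partition_of_bseq /=.
have /andP[/andP[_ la0] /eqP sla] := laP.
rewrite /insub_bseq insubdK; last first.
  by rewrite -topredE /= size_map -[X in _ <= X]sla size_le_sumn.
rewrite -map_comp map_id_in; last first.
  by move=> p /part_le_sumn; rewrite sla => ple; rewrite /= inordK.
by rewrite (insubT (fun la => is_partition la && (sumn la == n)) laP).
Qed.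

HB.instance Definition _ n : isFinite (partition_of n) :=
  PCanIsFinite (@partition_to_bseqK n).

(* The cell in row i, column j is the pair (i, j), both numbered from 0, rows
   going downwards. *)
Definition cells (la : seq nat) : seq (nat * nat) :=
  [seq (i, j) | i <- iota 0 (size la), j <- iota 0 (nth 0 la i)].

Definition leg (la : seq nat) (z : nat * nat) : nat :=
  count (fun w => (w.2 == z.2) && (z.1 < w.1)) (cells la).

Definition arm (la : seq nat) (z : nat * nat) : nat :=
  count (fun w => (w.1 == z.1) && (z.2 < w.2)) (cells la).

Definition r_stat (s : nat) (la : seq nat) : nat := count (fun p => s %| p) la.

Definition c_stat (s : nat) (la : seq nat) : nat :=
  count (fun z => (leg la z == 0) && (s %| (arm la z).+1)) (cells la).

Definition rem_seq (s : nat) (la : seq nat) : seq nat :=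
  [seq m <- [seq p %% s | p <- la] | m != 0].

(* Main.v *)
(* Writing each part as s q + e with 0 <= e < s, c_s(la) is q_1 minus the number
   of ascents of the word e (followed by 0).  Padding la with zero parts turns
   the condition r_s <= r into "exactly r parts are divisible by s".  With
   k = |rho| and q = x^s, the partitions with remainder sequence rho, r_s <= r
   and c_s <= c then have generating function

     x^w [k + r + c choose c]_q [k + r choose r]_q ,

   where w depends on rho only: the second factor is the major index
   distribution of the shuffles of rho with r zeros, the first one counts the
   remaining freedom in the quotients.  The product is x^w times the
   q-multinomial coefficient of (k, r, c), hence symmetric in r and c;
   inclusion-exclusion gives the symmetry of the exact counts. *)

Require Import Defs.
From mathcomp Require Import all_boot all_algebra zify ring.

Set Implicit Arguments.
Unset Strict Implicit.
Unset Printing Implicit Defensive.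

Import GRing.Theory Num.Theory.

(** * The column statistic as a sum of gap quotients *)

Lemma cells_cons x la :
  cells (x :: la) =
  [seq (0, j) | j <- iota 0 x] ++ [seq (w.1.+1, w.2) | w <- cells la].
Proof.
rewrite /cells /=; congr (_ ++ _).
rewrite -[1]addn0 iotaDl map_flatten -!map_comp.
by congr flatten; apply: eq_map => i /=; rewrite -map_comp.
Qed.

Lemma leg_consS x la i j : leg (x :: la) (i.+1, j) = leg la (i, j).
Proof.
rewrite /leg cells_cons count_cat !count_map (eq_count (a2 := pred0)) //=.
  by rewrite count_pred0.
by move=> k /=; rewrite andbF.
Qed.

Lemma arm_consS x la i j : arm (x :: la) (i.+1, j) = arm la (i, j).
Proof.
rewrite /arm cells_cons count_cat !count_map (eq_count (a2 := pred0)) //=.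
by rewrite count_pred0.
Qed.

Lemma count_gtn_iota x j : count (fun i => j < i) (iota 0 x) = x - j.+1.
Proof.
elim: x => // x IH.
by rewrite -[x.+1]addn1 iotaD count_cat IH /= add0n; case: ltnP; lia.
Qed.

Lemma arm_cons0 x la j : arm (x :: la) (0, j) = x - j.+1.
Proof.
rewrite /arm cells_cons count_cat !count_map /= -count_gtn_iota.
rewrite [X in _ + X](eq_count (a2 := pred0)) ?count_pred0 ?addn0 //.
Qed.

Lemma leg_cons0 x la j : sorted geq la ->
  (leg (x :: la) (0, j) == 0) = (head 0 la <= j).
Proof.
move=> srt; rewrite /leg cells_cons count_cat !count_map /=.
rewrite (eq_count (a2 := pred0)) ?count_pred0; last by move=> k /=; rewrite andbF.
rewrite add0n leqNgt -[_ == 0]negbK; congr (~~ _).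
rewrite -lt0n -has_count; apply/hasP/idP => [[[i k]]|lt_j].
  case/allpairsPdep=> [i' [k' [+ + [-> ->]]]] /=.
  rewrite !mem_iota /= !add0n => lti ltk /andP[/eqP<- _].
  (* The first row of [la] is its longest, so it reaches every column that some row reaches. *)
  apply: leq_trans ltk _; rewrite -nth0.
  have tr : transitive geq by move=> a b c /= ab bc; apply: leq_trans bc ab.
  apply: (sorted_leq_nth tr _ 0 srt) => //; first by move=> a /=.
  by rewrite inE; apply: leq_ltn_trans lti.
exists (0, j); last by rewrite /= eqxx.
case: la lt_j {srt} => // y la /= ltj.
by rewrite cells_cons mem_cat map_f // mem_iota.
Qed.

Lemma count_dvdn_iota s m : 0 < s -> count (fun i => s %| i.+1) (iota 0 m) = m %/ s.
Proof.
move=> s0; elim: m => [|m IH]; first by rewrite div0n.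
by rewrite -[m.+1]addn1 iotaD count_cat IH /= add0n addn0 addn1 divnS // addnC.
Qed.

(** Reading the row backwards, [i = x - j.+1], turns the arm into [i] and the columns from [h] on
    into [i < x - h], leaving the multiples of [s] up to [x - h]. *)
Lemma count_arm_iota s x h : 0 < s -> h <= x ->
  count (fun j => (h <= j) && (s %| (x - j.+1).+1)) (iota 0 x) = (x - h) %/ s.
Proof.
move=> s0 hx.
have /permP-> : perm_eq (iota 0 x) [seq x - i.+1 | i <- iota 0 x].
  apply: uniq_perm; rewrite ?iota_uniq //.
    rewrite map_inj_in_uniq ?iota_uniq // => i j; rewrite !mem_iota; lia.
  move=> j; rewrite mem_iota; apply/idP/mapP => [ltj|[i]].
    exists (x - j.+1); rewrite ?mem_iota; lia.
  rewrite mem_iota; lia.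
rewrite count_map -[X in iota _ X](subnK hx) iotaD count_cat.
rewrite (eq_in_count (a2 := fun i => s %| i.+1)); last first.
  move=> i; rewrite mem_iota /= => lti.
  have -> : h <= x - i.+1 by lia.
  by congr (_ %| _); lia.
rewrite count_dvdn_iota // (eq_in_count (a2 := pred0)) ?count_pred0 ?addn0 //.
by move=> i; rewrite mem_iota /= => lti; apply/negbTE; rewrite negb_and; lia.
Qed.

(** In the top row the cells with leg 0 are those from column [head 0 la] on; lower cells keep their
    arms and legs. *)
Lemma c_stat_cons s x la : 0 < s -> sorted geq (x :: la) ->
  c_stat s (x :: la) = (x - head 0 la) %/ s + c_stat s la.
Proof.
move=> s0 srt; have srt' := path_sorted srt.
have hx : head 0 la <= x by case: la srt {srt'} => //= y la /andP[].
rewrite /c_stat {1}cells_cons count_cat !count_map; congr (_ + _).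
  rewrite -count_arm_iota //; apply: eq_count => j /=.
  by rewrite leg_cons0 // arm_cons0.
by apply: eq_count => -[i j] /=; rewrite leg_consS arm_consS.
Qed.

(* [l] is listed in nondecreasing order, [p] being the part preceding it. *)
Fixpoint gap_quotients (s p : nat) (l : seq nat) : nat :=
  if l is x :: l' then (x - p) %/ s + gap_quotients s x l' else 0.

Lemma gap_quotients_rcons s p l x :
  gap_quotients s p (rcons l x) = gap_quotients s p l + (x - last p l) %/ s.
Proof. by elim: l p => [|y l IH] p /=; rewrite ?addn0 // IH addnA. Qed.

Lemma c_stat_rev s la : 0 < s -> sorted geq la ->
  c_stat s la = gap_quotients s 0 (rev la).
Proof.
move=> s0; elim: la => // x la IH srt.
rewrite c_stat_cons // IH ?(path_sorted srt) // rev_cons gap_quotients_rcons.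
by rewrite addnC; case: la {srt IH} => // y la; rewrite rev_cons last_rcons.
Qed.

(** * Building padded lists from the smallest entry *)

Definition raise (s : nat) (l : seq nat) : seq nat := map (addn s) l.

(* Prepends a part [b < s] below [l]; the rest is raised exactly when this creates
   an ascent of remainders, so that [gap_quotients] is unchanged. *)
Definition push (s b : nat) (l : seq nat) : seq nat :=
  b :: (if head 0 l %% s < b then raise s l else l).

(* [l] and [rho] are in reverse order with respect to partitions, and [l] may
   contain zeros, which count as parts divisible by [s]. *)
Definition padded (s : nat) (rho : seq nat) (r c : nat) (l : seq nat) : bool :=
  [&& sorted leq l, rem_seq s l == rho, r_stat s l == r & gap_quotients s 0 l <= c].

(* Enumerates the lists satisfying [padded], according to the smallest part: at
   least [s], zero, or strictly in between.  For the empty list the first clause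
   lets [c] grow. *)
Fixpoint padded_seqs (s : nat) (rho : seq nat) : nat -> nat -> seq (seq nat) :=
  fix fix_r r := fix fix_c c :=
    (if c is c'.+1 then map (raise s) (fix_c c') else [::]) ++
    (if r is r'.+1 then map (cons 0) (fix_r r' c) else [::]) ++
    (if rho is b :: rho' then map (push s b) (padded_seqs s rho' r c)
     else if (r == 0) && (c == 0) then [:: [::]] else [::]).

Lemma padded_seqsE s rho r c : padded_seqs s rho r c =
  (if c is c'.+1 then map (raise s) (padded_seqs s rho r c') else [::]) ++
  (if r is r'.+1 then map (cons 0) (padded_seqs s rho r' c) else [::]) ++
  (if rho is b :: rho' then map (push s b) (padded_seqs s rho' r c)
   else if (r == 0) && (c == 0) then [:: [::]] else [::]).
Proof. by case: rho r c => [|b rho] [|r] [|c]. Qed.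

Lemma rem_seq_cons s x l :
  rem_seq s (x :: l) = if s %| x then rem_seq s l else x %% s :: rem_seq s l.
Proof. by rewrite /rem_seq /= /dvdn; case: eqP. Qed.

Lemma size_rem_seq s l : size (rem_seq s l) + r_stat s l = size l.
Proof.
elim: l => // x l IH; rewrite rem_seq_cons /r_stat /= -/(r_stat s l) -IH.
by case: ifP => _ /=; lia.
Qed.

Lemma raise_inj s : injective (raise s).
Proof. exact/inj_map/addnI. Qed.

Lemma sorted_raise s l : sorted leq (raise s l) = sorted leq l.
Proof. by apply: mono_sorted => x y; rewrite leq_add2l. Qed.

Lemma rem_seq_raise s l : rem_seq s (raise s l) = rem_seq s l.
Proof.
by rewrite /rem_seq -map_comp; congr filter; apply: eq_map => x /=; rewrite modnDl.
Qed.

Lemma r_stat_raise s l : r_stat s (raise s l) = r_stat s l.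
Proof. by rewrite /r_stat count_map; apply: eq_count => x /=; rewrite dvdn_addr. Qed.

Lemma sumn_raise s l : sumn (raise s l) = sumn l + s * size l.
Proof. by elim: l => [|x l IH] /=; rewrite ?IH; lia. Qed.

Lemma head_raise s l : head 0 (raise s l) %% s = head 0 l %% s.
Proof. by case: l => //= x l; rewrite modnDl. Qed.

Lemma gap_quotients_raise_shift s p l :
  gap_quotients s (s + p) (raise s l) = gap_quotients s p l.
Proof. by elim: l p => //= x l IH p; rewrite IH subnDl. Qed.

(** Only the gap from 0 to the smallest entry changes, by [s]; the empty list has no such gap. *)
Lemma gap_quotients_raise s l : 0 < s ->
  gap_quotients s 0 (raise s l) = (l != [::]) + gap_quotients s 0 l.
Proof.
case: l => //= x l s0; rewrite gap_quotients_raise_shift !subn0.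
by rewrite divnDl // divnn s0 addnA.
Qed.

Lemma raise_subn s l : all (leq s) l -> raise s (map (subn^~ s) l) = l.
Proof.
move=> /allP ge; rewrite /raise -map_comp map_id_in // => x /ge /= lex.
by rewrite subnKC.
Qed.

Lemma sorted_all_leq m x l : sorted leq (x :: l) -> m <= x -> all (leq m) (x :: l).
Proof.
move=> srt mx; have /allP h := order_path_min leq_trans srt; apply/allP => y.
by rewrite inE => /predU1P[->//|/h]; apply: leq_trans mx.
Qed.

(** Raising keeps remainders, so the tail of [push s b l] reveals which branch was taken. *)
Lemma push_inj s b : injective (push s b).
Proof.
have hd l : head 0 (behead (push s b l)) %% s = head 0 l %% s.
  by rewrite /push /=; case: ifP => // _; rewrite head_raise.
move=> l1 l2 e; have := hd l1; rewrite e hd => eh.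
by case: e; rewrite eh; case: ifP => // _ /raise_inj.
Qed.

Lemma sorted_push s b l : b < s -> sorted leq l -> sorted leq (push s b l).
Proof.
move=> bs srt; case: l srt => [|x l] /= srt; first by case: ifP.
case: ifP => h /=.
  rewrite (leq_trans (ltnW bs) (leq_addr _ _)) /=.
  by have := sorted_raise s (x :: l); rewrite /= => ->.
rewrite srt andbT (leq_trans _ (leq_mod x s)) // leqNgt h //.
Qed.

Lemma rem_seq_push s b l : 0 < b < s -> rem_seq s (push s b l) = b :: rem_seq s l.
Proof.
move=> /andP[b0 bs]; rewrite rem_seq_cons /dvdn modn_small // gtn_eqF //.
by case: ifP; rewrite ?rem_seq_raise.
Qed.

Lemma r_stat_push s b l : 0 < b < s -> r_stat s (push s b l) = r_stat s l.
Proof.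
move=> /andP[b0 bs]; rewrite /r_stat /= /dvdn modn_small // gtn_eqF //.
by case: ifP; rewrite // -!/(r_stat _ _) r_stat_raise.
Qed.

(** For [x] the head of [l], the floor of (x - b)/s falls one short of that of x/s exactly when
    [x %% s < b], and then the raise makes up for it. *)
Lemma gap_quotients_push s b l : 0 < b < s ->
  gap_quotients s 0 (push s b l) = gap_quotients s 0 l.
Proof.
move=> /andP[b0 bs]; case: l => [|x l] /=; first by rewrite subn0 divn_small //; case: ifP.
rewrite !subn0 (divn_small bs) add0n.
have s0 : 0 < s by lia.
have := divn_eq x s; have := ltn_pmod x s0; case: ifP => h ms ex /=.
  rewrite gap_quotients_raise_shift; congr (_ + _).
  have -> : s + x - b = x %/ s * s + (s + x %% s - b) by lia.
  by rewrite divnMDl // [X in _ + X]divn_small ?addn0 //; lia.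
congr (_ + _); have -> : x - b = x %/ s * s + (x %% s - b).
  by rewrite {1}ex addnBA // leqNgt h.
by rewrite divnMDl // [X in _ + X]divn_small ?addn0 //; lia.
Qed.

Lemma sumn_push s b l :
  sumn (push s b l) = b + sumn l + (if head 0 l %% s < b then s * size l else 0).
Proof. by rewrite /push /=; case: ifP => _; rewrite ?sumn_raise; lia. Qed.

(** If the head [y] of the tail has remainder below [x], then [s <= y]: otherwise [y] is its own
    remainder, against [x <= y]. So the tail can be lowered by [s]. *)
Lemma cons_push s x l : x < s -> sorted leq (x :: l) ->
  exists2 l', x :: l = push s x l' & sorted leq l'.
Proof.
move=> xs srt; case h : (head 0 l %% s < x); last first.
  by exists l; rewrite /push ?h ?(path_sorted srt).
case: l srt h => [|y l] srt h; first by exists [::]; rewrite // /push; case: ifP.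
have ge_s : all (leq s) (y :: l).
  apply: sorted_all_leq (path_sorted srt) _.
  rewrite leqNgt; apply/negP => ys; move: h srt.
  by rewrite /= modn_small // ltnNge => /negbTE ->.
have er := raise_subn ge_s; exists (map (subn^~ s) (y :: l)).
  by rewrite /push er -head_raise er h.
by rewrite -(sorted_raise s) er; apply: path_sorted srt.
Qed.

(** * Correctness of the enumeration *)

Lemma padded_raise s rho r c l : 0 < s ->
  padded s rho r c l -> padded s rho r c.+1 (raise s l).
Proof.
move=> s0 /and4P[srt /eqP er /eqP ec gc]; apply/and4P; split.
- by rewrite sorted_raise.
- by rewrite rem_seq_raise er.
- by rewrite r_stat_raise ec.
- by rewrite gap_quotients_raise //; case: eqP => _; lia.
Qed.

Lemma padded_cons0 s rho r c l :
  padded s rho r.+1 c (0 :: l) = padded s rho r c l.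
Proof.
rewrite /padded rem_seq_cons dvdn0 /r_stat /= dvdn0 -/(r_stat s l) eqSS div0n add0n.
by congr [&& _, _, _ & _]; case: l.
Qed.

Lemma padded_push s b rho r c l : 0 < b < s -> sorted leq l ->
  padded s (b :: rho) r c (push s b l) = padded s rho r c l.
Proof.
move=> bP srt; rewrite /padded sorted_push ?srt //; last by case/andP: bP.
by rewrite rem_seq_push // r_stat_push // gap_quotients_push // eqseq_cons eqxx.
Qed.

(** Induction along the recursive calls of [padded_seqs], each of which shrinks one argument and
    keeps the other two. *)
Lemma rho_r_c_ind (P : seq nat -> nat -> nat -> Prop) :
  (forall rho r c,
     (if c is c'.+1 then P rho r c' else True) ->
     (if r is r'.+1 then P rho r' c else True) ->
     (if rho is b :: rho' then P rho' r c else True) -> P rho r c) ->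
  forall rho r c, P rho r c.
Proof.
by move=> step; elim=> [|b rho IHrho]; elim=> [|r IHr]; elim=> [|c IHc]; apply: step.
Qed.

Lemma padded_seqs_sub s rho r c l : 0 < s -> all (fun b => 0 < b < s) rho ->
  l \in padded_seqs s rho r c -> padded s rho r c l.
Proof.
move=> s0; move: rho r c l; apply: rho_r_c_ind => rho r c IHc IHr IHrho l rhoP.
rewrite padded_seqsE !mem_cat => /or3P[].
- case: c IHc {IHr IHrho} => // c IHc /mapP[l' /IHc-/(_ rhoP) h ->].
  exact: padded_raise.
- case: r IHr {IHc IHrho} => // r IHr /mapP[l' /IHr-/(_ rhoP) h ->].
  by rewrite padded_cons0.
- case: rho IHrho rhoP {IHc IHr} => [|b rho] IHrho.
    by case: r c => [|r] [|c] // _; rewrite inE => /eqP->.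
  case/andP=> bP rhoP /mapP[l' /IHrho-/(_ rhoP) h ->].
  by rewrite padded_push //; case/and4P: h.
Qed.

Lemma padded_seqs_sup s rho r c l : 0 < s -> all (fun b => 0 < b < s) rho ->
  padded s rho r c l -> l \in padded_seqs s rho r c.
Proof.
move=> s0; move: rho r c l; apply: rho_r_c_ind => rho r c IHc IHr IHrho l rhoP lP.
rewrite padded_seqsE !mem_cat.
have /and4P[srt /eqP erho /eqP er gc] := lP.
case: l => [|x l] in lP srt erho er gc *.
  (* The empty list lies in the base clause for [c = 0] and is its own raise for larger [c]. *)
  rewrite -erho -er in IHc *; case: c IHc {gc IHr IHrho lP} => [|c] IHc.
    by rewrite inE eqxx !orbT.
  by rewrite (map_f (raise s) (x := [::])) // IHc.
case: (leqP s x) => sx.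
  have ge_s := sorted_all_leq srt sx; have el := raise_subn ge_s.
  have nz : map (subn^~ s) (x :: l) != [::] by [].
  move: (map _ _) nz el lP => l' nz <-; rewrite /padded.
  rewrite sorted_raise rem_seq_raise r_stat_raise gap_quotients_raise // nz.
  case: c IHc {IHr IHrho gc} => [|c] IHc; first by rewrite !andbF.
  by rewrite add1n ltnS => lP; rewrite map_f // IHc.
case: (posnP x) => x0.
  rewrite x0 in lP er *; case: r IHr er lP {IHc IHrho} => [|r] IHr.
    by rewrite /r_stat /= dvdn0.
  by rewrite padded_cons0 => _ lP; rewrite (map_f (cons 0)) ?orbT // IHr.
move: erho; rewrite rem_seq_cons /dvdn modn_small // gtn_eqF // => erho.
have [l' el srt'] := cons_push sx srt.
case: rho IHrho erho rhoP lP {IHc IHr} => // b rho IHrho [<- _] /andP[bP rhoP].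
by rewrite el padded_push // => lP; rewrite (map_f (push s x)) ?orbT // IHrho.
Qed.

Lemma mem_padded_seqs s rho r c l : 0 < s -> all (fun b => 0 < b < s) rho ->
  (l \in padded_seqs s rho r c) = padded s rho r c l.
Proof.
by move=> s0 rhoP; apply/idP/idP; [apply: padded_seqs_sub | apply: padded_seqs_sup].
Qed.

(** Nonempty lists from different clauses differ in their smallest entry; the empty list comes from
    the first clause if [c > 0] and from the last if [c = 0]. *)
Lemma uniq_padded_seqs s rho r c : 0 < s -> all (fun b => 0 < b < s) rho ->
  uniq (padded_seqs s rho r c).
Proof.
move=> s0; move: rho r c; apply: rho_r_c_ind => rho r c IHc IHr IHrho rhoP.
rewrite padded_seqsE !cat_uniq has_cat negb_or; apply/and3P; split.
- by case: c IHc {IHr IHrho} => // c IHc; rewrite (map_inj_uniq (@raise_inj s)) IHc.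
- apply/andP; split.
    case: r {IHc IHr IHrho} => // r; case: c => [|c]; first by apply/hasP => -[].
    apply/hasP => -[_ /mapP[l1 _ ->] /mapP[[|x l2] _ //= []]]; lia.
  case: rho rhoP {IHc IHr IHrho} => [|b rho]; first by case: r c => [|r] [|c].
  case/andP=> bP _; case: c => [|c]; first by apply/hasP => -[].
  apply/hasP => -[_ /mapP[l1 _ ->] /mapP[[|x l2] _ //= []]]; lia.
apply/and3P; split.
- by case: r IHr {IHc IHrho} => // r IHr; rewrite map_inj_uniq ?IHr // => l1 l2 [].
- case: r {IHc IHr IHrho} => [|r]; first by apply/hasP => -[].
  case: rho rhoP => [|b rho]; first by [].
  by case/andP=> bP _; apply/hasP => -[_ /mapP[l1 _ ->] /mapP[l2 _ []]]; lia.
- case: rho IHrho rhoP {IHc IHr} => [|b rho] IHrho; first by case: ifP.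
  by case/andP=> _ rhoP; rewrite (map_inj_uniq (@push_inj s b)) IHrho.
Qed.

(** * Gaussian binomials *)

(* [qbinom q n m] is the Gaussian binomial coefficient [n + m choose m]. *)
Fixpoint qbinom (R : nzRingType) (q : R) (n : nat) : nat -> R :=
  fix qbinom_n m :=
    match n, m with
    | n'.+1, m'.+1 => (q ^+ n * qbinom_n m' + qbinom q n' m)%R
    | _, _ => 1%R
    end.

Arguments qbinom : simpl never.

Definition qfact (R : nzRingType) (q : R) (n : nat) : R :=
  (\prod_(i < n) (1 - q ^+ i.+1))%R.

Lemma qbinom0n (R : nzRingType) (q : R) m : qbinom q 0 m = 1%R.
Proof. by case: m. Qed.

Lemma qbinomn0 (R : nzRingType) (q : R) n : qbinom q n 0 = 1%R.
Proof. by case: n. Qed.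

Lemma qbinomSS (R : nzRingType) (q : R) n m :
  (qbinom q n.+1 m.+1 = q ^+ n.+1 * qbinom q n.+1 m + qbinom q n m.+1)%R.
Proof. by []. Qed.

Lemma qfactS (R : nzRingType) (q : R) n :
  (qfact q n.+1 = qfact q n * (1 - q ^+ n.+1))%R.
Proof. by rewrite /qfact big_ord_recr. Qed.

(** The factorial formula freed of division. The induction step rests on q^(n+1) (1 - q^(m+1)) + (1
    - q^(n+1)) = 1 - q^(n+m+2). *)
Lemma qbinom_fact (R : comNzRingType) (q : R) n m :
  (qbinom q n m * qfact q n * qfact q m = qfact q (n + m))%R.
Proof.
elim: n m => [|n IHn] m; first by rewrite qbinom0n add0n /qfact big_ord0 !mul1r.
elim: m => [|m IHm]; first by rewrite qbinomn0 addn0 /qfact big_ord0 mul1r mulr1.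
have := IHn m.+1; rewrite qbinomSS addSn addnS !qfactS => {}IHn.
move: IHm; rewrite addSn !qfactS => IHm.
transitivity (q ^+ n.+1 * (1 - q ^+ m.+1) * (qfact q (n + m) * (1 - q ^+ (n + m).+1)) +
   (1 - q ^+ n.+1) * (qfact q (n + m) * (1 - q ^+ (n + m).+1)))%R.
  by rewrite -{1}IHm -IHn; ring.
rewrite !exprS !exprD; ring.
Qed.

Section QBinomSymmetry.

Context (R : idomainType) (q : R) (q_neq1 : forall n, (q ^+ n.+1 != 1)%R).

Lemma qfact_neq0 n : (qfact q n != 0)%R.
Proof. by apply/prodf_neq0 => i _; rewrite subr_eq0 eq_sym. Qed.

Lemma qbinomC n m : qbinom q n m = qbinom q m n.
Proof.
apply: (mulIf (qfact_neq0 n)); apply: (mulIf (qfact_neq0 m)).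
by rewrite qbinom_fact mulrAC qbinom_fact addnC.
Qed.

(** The second Pascal rule, obtained from the first by symmetry; the generating functions need
    both. *)
Lemma qbinomSS_dual n m :
  (qbinom q n.+1 m.+1 = qbinom q n.+1 m + q ^+ m.+1 * qbinom q n m.+1)%R.
Proof. by rewrite qbinomC qbinomSS addrC ![qbinom q m.+1 _]qbinomC qbinomC. Qed.

(** Multiplied by [qfact q k], [qfact q r] and [qfact q c], each side becomes [qfact q (k + r + c)]:
    both are the q-multinomial coefficient. *)
Lemma qtrinomC k r c :
  (qbinom q (k + r) c * qbinom q k r = qbinom q (k + c) r * qbinom q k c)%R.
Proof.
have E a b : (qbinom q (k + a) b * qbinom q k a * qfact q k * qfact q a * qfact q b
    = qfact q (k + a + b))%R.
  by rewrite -qbinom_fact -[qfact q (k + a)]qbinom_fact; ring.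
apply: (mulIf (qfact_neq0 k)); apply: (mulIf (qfact_neq0 r)).
apply: (mulIf (qfact_neq0 c)); rewrite E addnAC -E; ring.
Qed.

End QBinomSymmetry.

(** * Generating functions of padded lists *)

Definition padded_gf (s : nat) (rho : seq nat) (r c : nat) (P : pred (seq nat)) :
    {poly int} :=
  (\sum_(l <- padded_seqs s rho r c | P l) 'X^(sumn l))%R.

(* The sum of [rho] plus [s] times its major index with respect to ascents
   ([rho] being reversed). *)
Fixpoint asc_weight (s : nat) (rho : seq nat) : nat :=
  if rho is b :: rho' then
    b + (if head 0 rho' < b then s * size rho' else 0) + asc_weight s rho'
  else 0.

Definition gf_total (s : nat) (rho : seq nat) (r c : nat) : {poly int} :=
  ('X^(asc_weight s rho) * qbinom 'X^s (size rho + r) c * qbinom 'X^s (size rho) r)%R.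

(** The share of [gf_total] due to lists whose head is not divisible by [s]. For nonempty [rho] and
    positive [r] it keeps the second term of [qbinomSS_dual] for [qbinom 'X^s (size rho) r]. *)
Definition gf_indivisible (s : nat) (rho : seq nat) (r c : nat) : {poly int} :=
  (if rho is _ :: rho' then
    'X^(asc_weight s rho) * 'X^s ^+ r * qbinom 'X^s (size rho + r) c *
    qbinom 'X^s (size rho') r
  else 0)%R.

Definition head_indivisible (s : nat) (l : seq nat) : bool := ~~ (s %| head 0 l).

Lemma polyXn_neq1 (R : nzRingType) s n : 0 < s -> ('X^s ^+ n.+1 != 1 :> {poly R})%R.
Proof.
move=> s0; rewrite -exprM; apply: contraTneq (oner_neq0 R) => /(congr1 (coefp 0)).
by rewrite /= coefXn coef1 [0 == _]eq_sym muln_eq0 !eqn0Ngt s0 /= => /esym/eqP ->.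
Qed.

Lemma size_padded s rho r c l : padded s rho r c l -> size l = size rho + r.
Proof. by case/and4P=> _ /eqP <- /eqP <- _; rewrite size_rem_seq. Qed.

Lemma head_padded s rho r c l : padded s rho r c l -> head_indivisible s l ->
  head 0 l %% s = head 0 rho.
Proof.
rewrite /head_indivisible; case/and4P=> _ /eqP <- _ _; case: l => [|x l]; first by rewrite dvdn0.
by rewrite rem_seq_cons /= => /negbTE ->.
Qed.

Lemma gf_raise s rho r c (P : pred (seq nat)) :
  0 < s -> all (fun b => 0 < b < s) rho -> (forall l, P (raise s l) = P l) ->
  (\sum_(l <- map (raise s) (padded_seqs s rho r c) | P l) 'X^(sumn l) =
   'X^s ^+ (size rho + r) * padded_gf s rho r c P)%R.
Proof.
move=> s0 rhoP PE; rewrite big_map mulr_sumr (eq_bigl P) // big_seq_cond.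
rewrite [RHS]big_seq_cond; apply: eq_bigr => l /andP[lin _].
rewrite sumn_raise -(size_padded (padded_seqs_sub s0 rhoP lin)).
by rewrite -exprM -exprD addnC.
Qed.

(** A nonempty rest with head divisible by [s] is always raised, as [0 < b]. Otherwise the head has
    remainder [head 0 rho], so the raise depends on [rho] and [b] alone. Hence the split by
    [head_indivisible]. *)
Lemma gf_push s b rho r c : 0 < s -> 0 < b < s -> all (fun b => 0 < b < s) rho ->
  padded_gf s rho r c predT = gf_total s rho r c ->
  padded_gf s rho r c (head_indivisible s) = gf_indivisible s rho r c ->
  (\sum_(l <- map (push s b) (padded_seqs s rho r c)) 'X^(sumn l) =
   'X^(asc_weight s (b :: rho)) * 'X^s ^+ r * qbinom 'X^s (size rho + r) c *
    qbinom 'X^s (size rho) r :> {poly int})%R.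
Proof.
move=> s0 bP rhoP EA EB.
have -> : (\sum_(l <- map (push s b) (padded_seqs s rho r c)) 'X^(sumn l) =
    'X^b * ('X^s ^+ (size rho + r) *
       (padded_gf s rho r c predT - padded_gf s rho r c (head_indivisible s)) +
      (if (head 0 rho < b)%N then 'X^s ^+ (size rho + r) else 1) *
        padded_gf s rho r c (head_indivisible s)) :> {poly int})%R.
  rewrite big_map /padded_gf [in X in (X - _)%R](bigID (head_indivisible s)).
  rewrite addrAC addrN add0r [LHS](bigID (head_indivisible s)) [LHS]addrC mulrDr.
  rewrite !mulr_sumr; congr (_ + _)%R; rewrite big_seq_cond [RHS]big_seq_cond;
    apply: eq_bigr => l /andP[lin]; have lP := padded_seqs_sub s0 rhoP lin.
    rewrite /head_indivisible negbK => /eqP hl; rewrite sumn_push hl; have [-> _] := andP bP.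
    by rewrite (size_padded lP) -exprM -!exprD; congr ('X^_)%R; lia.
  move=> hl; rewrite sumn_push (head_padded lP hl).
  case: ifP => _; last by rewrite mul1r -exprD addn0.
  by rewrite (size_padded lP) -exprM -!exprD; congr ('X^_)%R; lia.
rewrite EA EB /gf_total /gf_indivisible.
case: rho {EA EB} rhoP => [|a rho] rhoP.
  have [b0 _] := andP bP.
  by rewrite /= b0 muln0 !addn0 !add0n subr0 mulr0 addr0 !qbinom0n; ring.
rewrite [asc_weight s [:: b, a & rho]]/= -/(asc_weight s (a :: rho)).
set w := asc_weight _ _; set k := size (a :: rho).
rewrite [head _ _]/=; case: ifP => ab.
  (* Every list is raised here, so the two shares recombine. *)
  by rewrite !exprD !exprM; ring.
rewrite addn0 !exprD; case: r => [|r].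
  by rewrite !qbinomn0 !addn0 expr0; ring.
have -> : k = (size rho).+1 by [].
(* Only lists with head divisible by [s] are raised: the dual Pascal rule isolates them, and the
   power of ['X^s] gained by the raise turns the sum into the first rule. *)
rewrite [in RHS]qbinomSS (qbinomSS_dual (fun n => @polyXn_neq1 int s n s0)).
ring.
Qed.

(** The two formulas are proved together because [gf_push] uses both for the shorter [rho]. *)
Lemma padded_gfE s rho r c : 0 < s -> all (fun b => 0 < b < s) rho ->
  padded_gf s rho r c predT = gf_total s rho r c /\
  padded_gf s rho r c (head_indivisible s) = gf_indivisible s rho r c.
Proof.
move=> s0; have q_neq1 n := @polyXn_neq1 int s n s0.
move: rho r c; apply: rho_r_c_ind => rho r c IHc IHr IHrho rhoP.
have hiR l : head_indivisible s (raise s l) = head_indivisible s l.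
  by rewrite /head_indivisible /dvdn head_raise.
have hi0 l : head_indivisible s (0 :: l) = false by rewrite /head_indivisible dvdn0.
have padded_gf_rec P : (forall l, P (raise s l) = P l) -> padded_gf s rho r c P =
    ((if c is c'.+1 then 'X^s ^+ (size rho + r) * padded_gf s rho r c' P else 0) +
     ((if r is r'.+1 then \sum_(l <- padded_seqs s rho r' c | P (0%N :: l)) 'X^(sumn l)
       else 0) +
      \sum_(l <- (if rho is b :: rho' then map (push s b) (padded_seqs s rho' r c)
         else if (r == 0) && (c == 0) then [:: [::]] else [::]) | P l) 'X^(sumn l)))%R.
  move=> PE; rewrite {1}/padded_gf padded_seqsE !big_cat; congr (_ + (_ + _))%R.
    by case: c {IHc IHr IHrho} => [|c]; rewrite ?big_nil ?gf_raise.
  by case: r {IHc IHr IHrho} => [|r]; rewrite ?big_nil ?big_map.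
split; rewrite padded_gf_rec //.
  (* Each clause of the enumeration is replaced by its closed form; the Pascal rules do the rest. *)
  transitivity ((if c is c'.+1 then 'X^s ^+ (size rho + r) * gf_total s rho r c' else 0) +
     ((if r is r'.+1 then gf_total s rho r' c else 0) +
     (if rho is b :: rho' then 'X^(asc_weight s rho) * 'X^s ^+ r *
        qbinom 'X^s (size rho' + r) c * qbinom 'X^s (size rho') r
      else ((r == 0) && (c == 0))%N%:R)))%R.
    congr (_ + (_ + _))%R.
    - by case: c IHc {IHr IHrho padded_gf_rec} => // c [] // ->.
    - by case: r IHr {IHc IHrho padded_gf_rec} => // r [] // ->.
    - case: rho rhoP IHrho {IHc IHr padded_gf_rec} => [|b rho] /=.
        by case: ifP => _; rewrite ?big_nil // big_seq1 expr0.
      by case/andP=> bP rhoP [] // EA EB; apply: gf_push.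
  rewrite /gf_total; case: rho {rhoP IHc IHr IHrho padded_gf_rec} => [|b rho].
    case: r c => [|r] [|c]; rewrite /= ?qbinom0n ?qbinomn0 ?addn0 ?add0n ?expr0; try ring.
    by rewrite qbinomSS; ring.
  set w := asc_weight _ _; rewrite [size (b :: rho)]/=.
  case: r => [|r]; case: c => [|c]; rewrite ?qbinomn0 ?addn0 ?expr0; try ring.
  - by rewrite qbinomSS; ring.
  - by rewrite (qbinomSS_dual q_neq1); ring.
  (* Pascal in the first factor splits off the raised lists; the dual rule in the second separates a
     zero head from a pushed one. *)
  - rewrite !addSn !addnS [qbinom _ (size rho + r).+2 c.+1]qbinomSS.
    by rewrite !(qbinomSS_dual q_neq1 (size rho) r); ring.
(* A zero head is divisible by [s], so its clause drops out, while every pushed list counts. *)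
transitivity ((if c is c'.+1 then 'X^s ^+ (size rho + r) * gf_indivisible s rho r c'
     else 0) + (0 +
   (if rho is b :: rho' then 'X^(asc_weight s rho) * 'X^s ^+ r *
      qbinom 'X^s (size rho' + r) c * qbinom 'X^s (size rho') r else 0)))%R.
  congr (_ + (_ + _))%R.
  - by case: c IHc {IHr IHrho padded_gf_rec} => // c [] // _ ->.
  - case: r {IHc IHr IHrho padded_gf_rec} => // r.
    by rewrite big1 // => l; rewrite hi0.
  - case: rho rhoP IHrho {IHc IHr padded_gf_rec} => [|b rho] /=.
      move=> _ _; rewrite big1_seq // => l /andP[hl]; case: ifP => // _.
      by rewrite inE => /eqP el; rewrite el /head_indivisible dvdn0 in hl.
    case/andP=> bP rhoP [] // EA EB; rewrite -gf_push //.
    rewrite !big_map; apply: eq_bigl => l; have /andP[b0 bs] := bP.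
    by rewrite /head_indivisible /= /dvdn modn_small // -lt0n.
rewrite /gf_indivisible; case: rho {rhoP IHc IHr IHrho padded_gf_rec} => [|b rho].
  by case: c => [|c]; ring.
set w := asc_weight _ _; case: c => [|c]; rewrite ?qbinomn0 /=; first by ring.
by rewrite addSn [qbinom _ (size rho + r).+1 c.+1]qbinomSS; ring.
Qed.

Lemma coef_padded_gf s rho r c n :
  ((padded_gf s rho r c predT)`_n =
   (count (fun l => sumn l == n) (padded_seqs s rho r c))%:R)%R.
Proof.
rewrite coef_sum -sum1_count natr_sum [RHS]big_mkcond.
by apply: eq_bigr => l _; rewrite coefXn eq_sym; case: eqP.
Qed.

Lemma count_padded_seqsC s rho r c n : 0 < s -> all (fun b => 0 < b < s) rho ->
  count (fun l => sumn l == n) (padded_seqs s rho r c) =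
  count (fun l => sumn l == n) (padded_seqs s rho c r).
Proof.
move=> s0 rhoP; apply/eqP; rewrite -(eqr_nat int) -!coef_padded_gf.
rewrite !(proj1 (padded_gfE _ _ s0 rhoP)) /gf_total -mulrA.
by rewrite (qtrinomC (fun m => @polyXn_neq1 int s m s0)) mulrA.
Qed.

(** * From padded lists to partitions *)

Lemma sorted_nseq0_cat l : sorted leq l ->
  l = nseq (count_mem 0 l) 0 ++ [seq x <- l | x != 0].
Proof.
elim: l => // x l IH srt /=; case: eqP srt => [->|x0] srt /=.
  by rewrite -IH // (path_sorted srt).
have /andP[_ /allP h] : all (leq 1) (x :: l).
  by apply: sorted_all_leq; rewrite // lt0n; apply/eqP.
have -> : count_mem 0 l = 0 by apply/count_memPn/negP => /h.
by rewrite add0n /=; congr cons; apply/esym/all_filterP/allP => y /h; rewrite lt0n.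
Qed.

Lemma gap_quotients_nseq0 s m t :
  gap_quotients s 0 (nseq m 0 ++ t) = gap_quotients s 0 t.
Proof. by elim: m => //= m ->; rewrite subnn div0n. Qed.

Lemma rem_seq_nseq0 s m t : rem_seq s (nseq m 0 ++ t) = rem_seq s t.
Proof. by elim: m => //= m IH; rewrite rem_seq_cons dvdn0. Qed.

Lemma r_stat_nseq0 s m t : r_stat s (nseq m 0 ++ t) = m + r_stat s t.
Proof. by rewrite /r_stat count_cat count_nseq dvdn0 mul1n. Qed.

Lemma rem_seq_rev s l : rem_seq s (rev l) = rev (rem_seq s l).
Proof. by rewrite /rem_seq map_rev filter_rev. Qed.

Lemma r_stat_rev s l : r_stat s (rev l) = r_stat s l.
Proof. exact: count_rev. Qed.

Lemma sorted_leq_rev l : sorted leq (rev l) = sorted geq l.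
Proof. by rewrite rev_sorted. Qed.

(** Dropping zeros and reversing is a bijection from padded lists to partitions; its inverse pads
    with [r - r_stat s la] zeros, which leave the gap quotients unchanged. *)
Lemma card_bounded_stats s n rho r c : 0 < s -> all (fun b => 0 < b < s) rho ->
  #|[set la : partition_of n |
     [&& rem_seq s la == rev rho, r_stat s la <= r & c_stat s la <= c]]| =
  count (fun l => sumn l == n) (padded_seqs s rho r c).
Proof.
move=> s0 rhoP; set A := [set _ | _].
pose F l := rev [seq x <- l | x != 0] : seq nat.
pose L := [seq l <- padded_seqs s rho r c | sumn l == n].
rewrite cardE -(size_map (@parts n)) -size_filter -/L -[RHS](size_map F).
apply/perm_size/uniq_perm.
- by rewrite (map_inj_uniq (f := @parts n) val_inj) enum_uniq.
- rewrite map_inj_in_uniq ?filter_uniq ?uniq_padded_seqs // => l1 l2.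
  rewrite !mem_filter !mem_padded_seqs // => /andP[_ p1] /andP[_ p2].
  move=> /(can_inj revK) eF.
  have e1 := sorted_nseq0_cat (proj1 (andP p1)).
  have e2 := sorted_nseq0_cat (proj1 (andP p2)).
  (* Both lists have length [size rho + r], so equal nonzero entries force equally many zeros. *)
  have := size_padded p1; rewrite -(size_padded p2) e1 e2 eF !size_cat !size_nseq.
  by move=> /addIn ->.
move=> la; apply/mapP/mapP => [[x xA ->]|[l]].
  move: xA; rewrite mem_enum inE => /and3P[/eqP rm rr cc].
  have /andP[/andP[srt x0] /eqP sx] := valP x.
  exists (nseq (r - r_stat s x) 0 ++ rev x); last first.
    rewrite /F filter_cat filter_nseq eqxx /= filter_rev revK.
    by apply/esym/all_filterP/allP => y yx; apply: contraNneq x0 => <-.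
  rewrite mem_filter sumn_cat sumn_nseq mul0n add0n sumn_rev sx eqxx /=.
  rewrite mem_padded_seqs // /padded rem_seq_nseq0 rem_seq_rev rm revK eqxx.
  rewrite r_stat_nseq0 r_stat_rev subnK // eqxx gap_quotients_nseq0.
  rewrite -c_stat_rev // cc andbT /=.
  rewrite (sorted_pairwise leq_trans) pairwise_cat -!(sorted_pairwise leq_trans).
  rewrite sorted_leq_rev srt andbT; apply/andP; split.
    by apply/allrelP => a b /nseqP[-> _].
  by elim: (_ - _) => // -[].
rewrite mem_filter mem_padded_seqs // => /andP[/eqP sl lP] ->.
have /and4P[srt rm rr gc] := lP; have el := sorted_nseq0_cat srt.
set t := [seq x <- l | x != 0] in el.
have srt_t : sorted leq t by apply: sorted_filter srt; apply: leq_trans.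
have tP : is_partition (rev t) && (sumn (rev t) == n).
  rewrite /is_partition -sorted_leq_rev revK srt_t mem_rev mem_filter eqxx /=.
  by rewrite sumn_rev -sl [in X in _ == X]el sumn_cat sumn_nseq mul0n.
exists (PartitionOf tP) => //; rewrite mem_enum inE /= c_stat_rev ?revK; last first.
- by rewrite -sorted_leq_rev revK.
- by [].
rewrite rem_seq_rev r_stat_rev; apply/and3P; split.
- by rewrite -(eqP rm) el rem_seq_nseq0.
- by rewrite -(eqP rr) [in X in _ <= X]el r_stat_nseq0 leq_addl.
- by rewrite (leq_trans _ gc) // [in X in _ <= X]el gap_quotients_nseq0.
Qed.

(** * Inclusion-exclusion and the symmetry *)

(** Negative terms are moved across to stay in [nat]; the identity is checked element by element. *)
Lemma card_stat_incl_excl (T : finType) (P : pred T) (f g : T -> nat) r c :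
  #|[set x | [&& P x, f x <= r & g x <= c]]| + #|[set x | [&& P x, f x < r & g x < c]]| =
  #|[set x | P x && ((f x, g x) == (r, c))]| +
  (#|[set x | [&& P x, f x < r & g x <= c]]| + #|[set x | [&& P x, f x <= r & g x < c]]|).
Proof.
rewrite !cardsE -!sum1_card !(big_mkcond (fun x => x \in _)) -!big_split.
apply: eq_bigr => x _; rewrite !unfold_in /= xpair_eqE.
by case: (P x) => //=; case: (ltngtP (f x)); case: (ltngtP (g x)).
Qed.

Theorem theorem2p1 (s n : nat) (rho : seq nat) (r c : nat) :
  0 < s -> 0 < n ->
  (forall m : nat, m \in rho -> 1 <= m <= s - 1) ->
  #|[set la : partition_of n |
      (rem_seq s la == rho) && ((r_stat s la, c_stat s la) == (r, c))]| =
  #|[set la : partition_of n |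
      (rem_seq s la == rho) && ((r_stat s la, c_stat s la) == (c, r))]|.
Proof.
move=> s0 _ rhoP.
have rhoP' : all (fun b => 0 < b < s) (rev rho).
  by apply/allP => b; rewrite mem_rev => /rhoP; lia.
(* With strict bounds, a bound 0 gives the empty set, so inclusion-exclusion has the same form on
   the boundary. *)
pose M a b := #|[set la : partition_of n |
  [&& rem_seq s la == rho, r_stat s la < a & c_stat s la < b]]|.
have M0 b : M 0 b = 0 by apply: eq_card0 => x; rewrite !inE andbF.
have M0r a : M a 0 = 0 by apply: eq_card0 => x; rewrite !inE !andbF.
have ME a b : M a.+1 b.+1 =
    count (fun l => sumn l == n) (padded_seqs s (rev rho) a b).
  by rewrite -card_bounded_stats // revK.
have MC a b : M a b = M b a.
  case: a b => [|a] [|b]; rewrite ?M0 ?M0r //.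
  by rewrite !ME count_padded_seqsC.
have IE a b : M a.+1 b.+1 + M a b =
    #|[set la : partition_of n |
        (rem_seq s la == rho) && ((r_stat s la, c_stat s la) == (a, b))]| +
    (M a b.+1 + M a.+1 b).
  exact: (card_stat_incl_excl (fun la : partition_of n => rem_seq s la == rho)
    (r_stat s) (c_stat s)).
(* As [M] is symmetric, the identities at (c, r) and (r, c) differ only in the exact counts. *)
have := IE c r; rewrite [M c.+1 r.+1]MC [M c r]MC [M c r.+1]MC [M c.+1 r]MC IE.
by rewrite [M r.+1 c + _]addnC => /addIn.
Qed.
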